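(* Let $\mathcal{R}(S_6)$ be the complex representation ring of $S_6$. Under the correspondence $[V_1]\leftrightarrow 1$, $[V_{i+1}]\leftrightarrow x_i$ ($1\le i\le 10$), with $V_1,\dots,V_{11}$ the irreducible complex representations of $S_6$ numbered by the character table given in the context, there is a ring isomorphism $$\mathcal{R}(S_6)\cong \mathbb{Z}[x_1,x_2,\dots,x_{10}]/(y_1,y_2,\dots,y_{55}),$$ where \begin{align*} &y_1=x_1^2-1,\quad y_2=x_2x_1-x_3,\quad y_3=x_3x_1-x_2,\quad y_4=x_4x_1-x_5,\quad y_5=x_5x_1-x_4,\\ &y_6=x_6x_1-x_7,\quad y_7=x_7x_1-x_6,\quad y_8=x_8x_1-x_9,\quad y_9=x_9x_1-x_8,\quad y_{10}=x_{10}x_1-x_{10},\\ &y_{11}=x_2^2-x_6-x_4-x_2-1,\quad y_{12}=x_3x_2-x_7-x_5-x_3-x_1,\\ &y_{13}=x_4x_2-x_{10}-x_8-x_6-x_4-x_2,\quad y_{14}=x_5x_2-x_{10}-x_9-x_7-x_5-x_3,\\ &y_{15}=x_6x_2-x_{10}-x_7-x_6-x_4-x_2,\quad y_{16}=x_7x_2-x_{10}-x_7-x_6-x_5-x_3,\\ &y_{17}=x_8x_2-x_{10}-x_4,\quad y_{18}=x_9x_2-x_{10}-x_5,\\ &y_{19}=x_{10}x_2-2x_{10}-x_9-x_8-x_7-x_6-x_5-x_4,\\ &y_{20}=x_3^2-x_6-x_4-x_2-1,\\ &y_{21}=x_4x_3-x_{10}-x_9-x_7-x_5-x_3,\quad y_{22}=x_5x_3-x_{10}-x_8-x_6-x_4-x_2,\\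 &y_{23}=x_6x_3-x_{10}-x_7-x_6-x_5-x_3,\quad y_{24}=x_7x_3-x_{10}-x_7-x_6-x_4-x_2,\\ &y_{25}=x_8x_3-x_{10}-x_5,\quad y_{26}=x_9x_3-x_{10}-x_4,\\ &y_{27}=x_{10}x_3-2x_{10}-x_9-x_8-x_7-x_6-x_5-x_4,\\ &y_{28}=x_4^2-2x_{10}-x_9-x_7-x_6-2x_4-x_2-1,\\ &y_{29}=x_5x_4-2x_{10}-x_8-x_7-x_6-2x_5-x_3-x_1,\\ &y_{30}=x_6x_4-2x_{10}-x_8-x_7-2x_6-x_5-x_4-x_2,\\ &y_{31}=x_7x_4-2x_{10}-x_9-2x_7-x_6-x_5-x_4-x_3,\\ &y_{32}=x_8x_4-x_{10}-x_8-x_6-x_5-x_2,\quad y_{33}=x_9x_4-x_{10}-x_9-x_7-x_4-x_3,\\ &y_{34}=x_{10}x_4-3x_{10}-x_9-x_8-2x_7-2x_6-2x_5-2x_4-x_3-x_2,\\ &y_{35}=x_5^2-2x_{10}-x_9-x_7-x_6-2x_4-x_2-1,\\ &y_{36}=x_6x_5-2x_{10}-x_9-2x_7-x_6-x_5-x_4-x_3,\\ &y_{37}=x_7x_5-2x_{10}-x_8-x_7-2x_6-x_5-x_4-x_2,\\ &y_{38}=x_8x_5-x_{10}-x_9-x_7-x_4-x_3,\quad y_{39}=x_9x_5-x_{10}-x_8-x_6-x_5-x_2,\\ &y_{40}=x_{10}x_5-3x_{10}-x_9-x_8-2x_7-2x_6-2x_5-2x_4-x_3-x_2,\\ &y_{41}=x_6^2-2x_{10}-x_9-x_8-x_7-x_6-x_5-2x_4-x_3-x_2-1,\\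 &y_{42}=x_7x_6-2x_{10}-x_9-x_8-x_7-x_6-2x_5-x_4-x_3-x_2-x_1,\\ &y_{43}=x_8x_6-x_{10}-x_9-x_7-x_6-x_4,\quad y_{44}=x_9x_6-x_{10}-x_8-x_7-x_6-x_5,\\ &y_{45}=x_{10}x_6-4x_{10}-x_9-x_8-2x_7-2x_6-2x_5-2x_4-x_3-x_2,\\ &y_{46}=x_7^2-2x_{10}-x_9-x_8-x_7-x_6-x_5-2x_4-x_3-x_2-1,\\ &y_{47}=x_8x_7-x_{10}-x_8-x_7-x_6-x_5,\quad y_{48}=x_9x_7-x_{10}-x_9-x_7-x_6-x_4,\\ &y_{49}=x_{10}x_7-4x_{10}-x_9-x_8-2x_7-2x_6-2x_5-2x_4-x_3-x_2,\\ &y_{50}=x_8^2-x_9-x_7-x_4-1,\quad y_{51}=x_9x_8-x_8-x_6-x_5-x_1,\\ &y_{52}=x_{10}x_8-2x_{10}-x_7-x_6-x_5-x_4-x_3-x_2,\\ &y_{53}=x_9^2-x_9-x_7-x_4-1,\quad y_{54}=x_{10}x_9-2x_{10}-x_7-x_6-x_5-x_4-x_3-x_2,\\ &y_{55}=x_{10}^2-5x_{10}-2x_9-2x_8-4x_7-4x_6-3x_5-3x_4-2x_3-2x_2-x_1-1. \end{align*}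
   Context: For a finite group $G$ with irreducible complex representations $V_1,\dots,V_s$ (up to isomorphism), the representation ring $\mathcal{R}(G)$ is the unital commutative ring with $\mathbb{Z}$-basis $[V_1],\dots,[V_s]$ whose operations are determined by $[M]+[N]=[M\oplus N]$ and $[M]\cdot[N]=[M\otimes N]$ for finite-dimensional complex representations $M,N$ of $G$, where $[M]$ is the isomorphism class of $M$. The irreducible complex representation $V_i$ of $S_6$ is the one with character $\chi_i$ in the following table, where the columns are the conjugacy classes of $g_1,\dots,g_{11}$ with the given cycle types and sizes. $$\begin{array}{c|ccccccccccc} & g_1&g_2&g_3&g_4&g_5&g_6&g_7&g_8&g_9&g_{10}&g_{11}\\ \text{cycle type} & 1^6 & 2\,1^4 & 3\,2\,1 & 2^3 & 4\,1^2 & 6 & 2^2 1^2 & 3\,1^3 & 5\,1 & 4\,2 & 3^2\\ \text{size} & 1&15&120&15&90&120&45&40&144&90&40\\ \hline \chi_1&1&1&1&1&1&1&1&1&1&1&1\\ \chi_2&1&-1&-1&-1&-1&-1&1&1&1&1&1\\ \chi_3&5&3&0&-1&1&-1&1&2&0&-1&-1\\ \chi_4&5&-3&0&1&-1&1&1&2&0&-1&-1\\ \chi_5&9&3&0&3&-1&0&1&0&-1&1&0\\ \chi_6&9&-3&0&-3&1&0&1&0&-1&1&0\\ \chi_7&10&2&-1&-2&0&1&-2&1&0&0&1\\ \chi_8&10&-2&1&2&0&-1&-2&1&0&0&1\\ \chi_9&5&1&1&-3&-1&0&1&-1&0&-1&2\\ \chi_{10}&5&-1&-1&3&1&0&1&-1&0&-1&2\\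 \chi_{11}&16&0&0&0&0&0&0&-2&1&0&-2 \end{array}$$ *)

(* Defs.v *)
From HB Require Import structures.
From mathcomp Require Import all_boot all_order all_algebra all_fingroup.
From mathcomp Require Import all_solvable all_character.
From mathcomp Require Import mpoly complex.
From mathcomp Require Import boolp reals.

Set Implicit Arguments.
Unset Strict Implicit.
Unset Printing Implicit Defensive.

Import Order.TTheory GRing.Theory Num.Theory.
Local Open Scope ring_scope.

(* Finite-dimensional representations over F are matrix representations
   ([representation F G] packs the degree); direct sum is [dadd_grepr], tensor
   product is [prod_repr] and isomorphism is [mx_rsim].  F stands for any
   algebraically closed number field structure, e.g. R[i] with R : realType. *)
Section RepresentationRing.

Variables (F : numClosedFieldType) (gT : finGroupType) (G : {group gT}).

(* The isomorphism classes of irreducible representations of G, indexed by the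
   isotypic components of the regular representation. *)
Definition irrep_index : irrType F G := DecSocleType (regular_repr F G).

Implicit Types (W : irrep_index) (M N : representation F G).

Definition irr_grepr W : representation F G := Representation (irr_repr W).

(* Of degree 1 by [degree_irr1] and trivial by [irr1_repr]. *)
Definition triv_grepr : representation F G := irr_grepr (principal_comp irrep_index).

Definition tensor_grepr M N : representation F G := Representation (prod_repr M N).

(* Multiplicity of W in M: the multiplicity of the isotypic component of M whose
   simple submodules are isomorphic to W, or 0 when there is none. *)
Definition irr_mult M W : nat :=
  oapp (fun S : DecSocleType M => socle_mult S) 0%N
    [pick S : DecSocleType M | irr_comp irrep_index (socle_repr S) == W].

(* The free Z-module on the irreducible classes. *)
Definition rep_ring : Type := {ffun irrep_index -> int}.

HB.instance Definition _ := GRing.Zmodule.on rep_ring.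

Definition rep_class M : rep_ring := [ffun W => (irr_mult M W)%:Z].

(* [V] * [W] = [V (x) W] on irreducible representations, extended bilinearly. *)
Definition rep_mul (x y : rep_ring) : rep_ring :=
  \sum_(V : irrep_index) \sum_(W : irrep_index)
    rep_class (tensor_grepr (irr_grepr V) (irr_grepr W)) *~ (x V * y W).

Definition rep_one : rep_ring := rep_class triv_grepr.

Lemma pchar'_group : ([pchar F]^'.-group G)%g.
Proof. by apply/pgroupP=> p _ _; rewrite inE /= pchar_num. Qed.

Lemma grepr_decomposition M :
  mx_rsim M (\big[dadd_grepr/grepr0]_(W : irrep_index)
               muln_grepr (irr_grepr W) (irr_mult M W)).
Proof.
case: M => n rG; pose sG := DecSocleType rG.
have C'G := pchar'_group.
pose soc i := [pick S : sG | irr_comp irrep_index (socle_repr S) == i].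
pose U i := oapp val 0 (soc i); pose S := (\sum_i U i)%MS.
have [defS dxS]: (S :=: 1%:M)%MS /\ mxdirect S.
  rewrite /S mxdirectE /= !(bigID soc xpredT) /=.
  rewrite addsmxC big1 => [|i]; last by rewrite /U; case (soc i).
  rewrite adds0mx_id addnC (@big1 nat) ?add0n => [|i]; last first.
    by rewrite /U; case: (soc i); rewrite ?mxrank0.
  have <-: Socle sG = 1%:M := reducible_Socle1 sG (mx_Maschke_pchar rG C'G).
  have [W0 _ | noW] := pickP sG; last first.
    suff no_i: (soc : pred irrep_index) =1 xpred0.
      by rewrite /Socle !big_pred0 ?mxrank0.
    by move=> i; rewrite /soc; case: pickP => // W0; have:= noW W0.
  have irrK Wi : soc (irr_comp irrep_index (socle_repr Wi)) = Some Wi.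
    rewrite /soc; case: pickP => [W' | /(_ Wi)] /= /eqP // eqWi.
    apply/eqP/socle_rsimP.
    apply: mx_rsim_trans
      (rsim_irr_comp_pchar irrep_index C'G (socle_irr _)) (mx_rsim_sym _).
    by rewrite eqWi; apply: rsim_irr_comp_pchar (socle_irr _).
  have bij_irr: {on [pred i | soc i], bijective
      (fun Wi : sG => irr_comp irrep_index (socle_repr Wi))}.
    exists (odflt W0 \o soc) => [Wi _ | i]; first by rewrite /= irrK.
    by rewrite inE /soc /=; case: pickP => //= Wi; move/eqP.
  rewrite !(reindex (fun Wi : sG => irr_comp irrep_index (socle_repr Wi))) {bij_irr}//=.
  have all_soc (Wi : sG) : soc (irr_comp irrep_index (socle_repr Wi)) by rewrite irrK.
  rewrite (eq_bigr val) => [|Wi _]; last by rewrite /U irrK.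
  rewrite !(eq_bigl _ _ all_soc); split=> //.
  rewrite (eq_bigr (mxrank \o val)) => [|Wi _]; last by rewrite /U irrK.
  by rewrite -mxdirectE /= Socle_direct.
pose modU i : mxmodule rG (U i) :=
  if soc i is Some Wi as oWi return mxmodule rG (oapp val 0 oWi) then
    component_mx_module rG (socle_base Wi)
  else mxmodule0 rG n.
apply: mx_rsim_trans (mx_rsim_sym (rsim_submod1 (mxmodule1 rG) _)) _ => //.
apply: mx_rsim_dsum (modU) _ defS dxS _ => i.
rewrite /U /irr_mult /modU /soc; case: pickP => [Wi|_] /=; last first.
  rewrite /muln_grepr big_ord0.
  by exists 0 => [||x _]; rewrite /row_free ?mxrank0 ?mulmx0 ?mul0mx.
move/eqP=> <-; apply: mx_rsim_socle.
exact: rsim_irr_comp_pchar (socle_irr Wi).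
Qed.

Definition rep_char (x : rep_ring) (g : gT) : F :=
  \sum_(W : irrep_index) \tr (irr_repr W g) *~ x W.

Lemma mxtrace_rsim n1 n2 (rG1 : mx_representation F G n1)
    (rG2 : mx_representation F G n2) g :
  mx_rsim rG1 rG2 -> g \in G -> \tr (rG1 g) = \tr (rG2 g).
Proof.
case/mx_rsim_def=> f12 [f21] fK def_rG1 Gg.
by rewrite def_rG1 // mxtrace_mulC mulmxA fK mul1mx.
Qed.

Lemma mxtrace_dsum (I : Type) (r : seq I) (P : pred I)
    (rG : I -> representation F G) g :
  \tr ((\big[dadd_grepr/grepr0]_(i <- r | P i) rG i) g)
    = \sum_(i <- r | P i) \tr (rG i g).
Proof.
pose phi M := \tr (M g).
rewrite -[LHS]/(phi _) (big_morph phi (id1 := 0) (op1 := +%R)) //.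
  by move=> M N; rewrite /phi /= mxtrace_block.
by rewrite /phi /= mxtrace1.
Qed.

Lemma rep_charE M g : g \in G -> rep_char (rep_class M) g = \tr (M g).
Proof.
move=> Gg; rewrite (mxtrace_rsim (grepr_decomposition M) Gg) mxtrace_dsum.
apply: eq_bigr => W _; rewrite ffunE -pmulrn /muln_grepr mxtrace_dsum /=.
by rewrite sumr_const card_ord.
Qed.

Lemma rep_charB x y g : rep_char (x - y) g = rep_char x g - rep_char y g.
Proof.
rewrite /rep_char -sumrB; apply: eq_bigr => W _.
by rewrite !ffunE mulrzBr.
Qed.

Lemma rep_char0 g : rep_char 0 g = 0.
Proof. by rewrite /rep_char big1 // => W _; rewrite ffunE mulr0z. Qed.

Lemma rep_charD x y g : rep_char (x + y) g = rep_char x g + rep_char y g.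
Proof.
rewrite /rep_char -big_split; apply: eq_bigr => W _.
by rewrite !ffunE mulrzDr.
Qed.

Lemma rep_charMz x m g : rep_char (x *~ m) g = rep_char x g *~ m.
Proof.
have chMn k : rep_char (x *+ k) g = rep_char x g *+ k.
  by elim: k => [|k IHk]; rewrite ?mulr0n ?rep_char0 // !mulrS rep_charD IHk.
case: m => k; first by rewrite -!pmulrn chMn.
by rewrite !NegzE !mulrNz -!pmulrn -sub0r rep_charB rep_char0 sub0r chMn.
Qed.

Lemma rep_char_sum (I : Type) (r : seq I) (x : I -> rep_ring) g :
  rep_char (\sum_(i <- r) x i) g = \sum_(i <- r) rep_char (x i) g.
Proof.
by apply: (big_morph (rep_char^~ g)) => [y z|]; rewrite ?rep_charD ?rep_char0.
Qed.

Lemma rep_charM x y g :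
  g \in G -> rep_char (rep_mul x y) g = rep_char x g * rep_char y g.
Proof.
move=> Gg; rewrite rep_char_sum [in RHS]/rep_char mulr_suml.
apply: eq_bigr => V _; rewrite rep_char_sum mulr_sumr.
apply: eq_bigr => W _; rewrite rep_charMz rep_charE //= mxtrace_prod.
by rewrite mulrzAr mulrzAl -mulrzA.
Qed.

Lemma rep_char1 g : g \in G -> rep_char rep_one g = 1.
Proof.
move=> Gg; rewrite rep_charE //= irr1_repr // mxtrace1.
by rewrite degree_irr1.
Qed.

Lemma rep_char_inj x y :
  {in G, forall g, rep_char x g = rep_char y g} -> x = y.
Proof.
move=> eq_xy; apply/eqP; rewrite -subr_eq0; set z := x - y.
have z0 g : g \in G -> rep_char z g = 0.
  by move=> Gg; rewrite rep_charB eq_xy ?subrr.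
apply/eqP/ffunP => W; rewrite [RHS]ffunE.
pose E := Wedderburn_id W.
have C'G := pchar'_group.
have: (E \in group_ring F G)%MS.
  rewrite -(Wedderburn_sum_pchar irrep_index C'G) (sumsmx_sup W) //.
  exact: Wedderburn_id_mem.
case/envelop_mxP=> a defE.
have trE V : \tr (gring_op (irr_repr V) E) = \sum_(g in G) a g * \tr (irr_repr V g).
  rewrite defE !linear_sum; apply: eq_bigr => g Gg.
  by rewrite !linearZ /= gring_opG.
have: \sum_(V : irrep_index) \tr (gring_op (irr_repr V) E) *~ z V = 0.
  under eq_bigr => V _ do rewrite trE mulrz_suml.
  rewrite exchange_big big1 //= => g Gg.
  under eq_bigr => V _ do rewrite -mulrzAr.
  by rewrite -mulr_sumr -/(rep_char z g) z0 // mulr0.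
rewrite (bigD1 W) //= big1 ?addr0 => [|V neqVW]; last first.
  by rewrite (irr_repr'_op0_pchar C'G _ (Wedderburn_id_mem W)) 1?eq_sym //
             linear0 mul0rz.
rewrite op_Wedderburn_id_pchar // mxtrace1 => /eqP.
rewrite mulrz_eq0 pnatr_eq0 orbC => /orP[|/eqP //].
by rewrite (gtn_eqF (irr_degree_gt0 W)).
Qed.

Lemma rep_mulA : associative rep_mul.
Proof. by move=> x y z; apply: rep_char_inj => g Gg; rewrite !rep_charM // mulrA. Qed.

Lemma rep_mulC : commutative rep_mul.
Proof. by move=> x y; apply: rep_char_inj => g Gg; rewrite !rep_charM // mulrC. Qed.

Lemma rep_mul1 : left_id rep_one rep_mul.
Proof.
by move=> x; apply: rep_char_inj => g Gg; rewrite rep_charM ?rep_char1 ?mul1r.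
Qed.

Lemma rep_mulDl : left_distributive rep_mul +%R.
Proof.
move=> x y z; apply: rep_char_inj => g Gg.
by rewrite !(rep_charM, rep_charD) // mulrDl.
Qed.

Lemma rep_one_neq0 : rep_one != 0.
Proof.
apply/eqP=> /(congr1 (rep_char^~ 1%g)); rewrite rep_char1 ?group1 // rep_char0.
by move/eqP; rewrite oner_eq0.
Qed.

HB.instance Definition _ := GRing.Zmodule_isComNzRing.Build rep_ring
  rep_mulA rep_mulC rep_mul1 rep_mulDl rep_one_neq0.

Lemma rep_class_rsim M N : mx_rsim M N -> rep_class M = rep_class N.
Proof.
by move=> simMN; apply: rep_char_inj => g Gg; rewrite !rep_charE ?(mxtrace_rsim simMN).
Qed.

Lemma rep_class_dadd M N : rep_class (dadd_grepr M N) = rep_class M + rep_class N.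
Proof.
by apply: rep_char_inj => g Gg; rewrite rep_charD !rep_charE //= mxtrace_block.
Qed.

Lemma rep_class_tensor M N : rep_class (tensor_grepr M N) = rep_class M * rep_class N.
Proof.
by apply: rep_char_inj => g Gg; rewrite rep_charM // !rep_charE //= mxtrace_prod.
Qed.

Lemma rep_class_irr W : rep_class (irr_grepr W) = [ffun V => (V == W)%:Z].
Proof.
apply: rep_char_inj => g Gg; rewrite rep_charE // /rep_char (bigD1 W) //= ffunE.
by rewrite eqxx big1 ?addr0 // => V /negPf neqVW; rewrite ffunE neqVW.
Qed.

Lemma rep_ring_basis (x : rep_ring) :
  x = \sum_(W : irrep_index) rep_class (irr_grepr W) *~ x W.
Proof.
apply: rep_char_inj => g Gg; rewrite rep_char_sum; apply: eq_bigr => W _.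
by rewrite rep_charMz rep_charE.
Qed.

End RepresentationRing.

Definition ideal_gen (A : comNzRingType) (s : seq A) : {pred A} :=
  fun p => `[< exists c : 'I_(size s) -> A, p = \sum_i c i * s`_i >].

Definition S6_relations (A : comNzRingType)
    (x1 x2 x3 x4 x5 x6 x7 x8 x9 x10 : A) : seq A :=
  [:: x1 ^+ 2 - 1;
      x2 * x1 - x3;
      x3 * x1 - x2;
      x4 * x1 - x5;
      x5 * x1 - x4;
      x6 * x1 - x7;
      x7 * x1 - x6;
      x8 * x1 - x9;
      x9 * x1 - x8;
      x10 * x1 - x10;
      x2 ^+ 2 - x6 - x4 - x2 - 1;
      x3 * x2 - x7 - x5 - x3 - x1;
      x4 * x2 - x10 - x8 - x6 - x4 - x2;
      x5 * x2 - x10 - x9 - x7 - x5 - x3;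
      x6 * x2 - x10 - x7 - x6 - x4 - x2;
      x7 * x2 - x10 - x7 - x6 - x5 - x3;
      x8 * x2 - x10 - x4;
      x9 * x2 - x10 - x5;
      x10 * x2 - 2 * x10 - x9 - x8 - x7 - x6 - x5 - x4;
      x3 ^+ 2 - x6 - x4 - x2 - 1;
      x4 * x3 - x10 - x9 - x7 - x5 - x3;
      x5 * x3 - x10 - x8 - x6 - x4 - x2;
      x6 * x3 - x10 - x7 - x6 - x5 - x3;
      x7 * x3 - x10 - x7 - x6 - x4 - x2;
      x8 * x3 - x10 - x5;
      x9 * x3 - x10 - x4;
      x10 * x3 - 2 * x10 - x9 - x8 - x7 - x6 - x5 - x4;
      x4 ^+ 2 - 2 * x10 - x9 - x7 - x6 - 2 * x4 - x2 - 1;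
      x5 * x4 - 2 * x10 - x8 - x7 - x6 - 2 * x5 - x3 - x1;
      x6 * x4 - 2 * x10 - x8 - x7 - 2 * x6 - x5 - x4 - x2;
      x7 * x4 - 2 * x10 - x9 - 2 * x7 - x6 - x5 - x4 - x3;
      x8 * x4 - x10 - x8 - x6 - x5 - x2;
      x9 * x4 - x10 - x9 - x7 - x4 - x3;
      x10 * x4 - 3 * x10 - x9 - x8 - 2 * x7 - 2 * x6 - 2 * x5 - 2 * x4 - x3
        - x2;
      x5 ^+ 2 - 2 * x10 - x9 - x7 - x6 - 2 * x4 - x2 - 1;
      x6 * x5 - 2 * x10 - x9 - 2 * x7 - x6 - x5 - x4 - x3;
      x7 * x5 - 2 * x10 - x8 - x7 - 2 * x6 - x5 - x4 - x2;
      x8 * x5 - x10 - x9 - x7 - x4 - x3;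
      x9 * x5 - x10 - x8 - x6 - x5 - x2;
      x10 * x5 - 3 * x10 - x9 - x8 - 2 * x7 - 2 * x6 - 2 * x5 - 2 * x4 - x3
        - x2;
      x6 ^+ 2 - 2 * x10 - x9 - x8 - x7 - x6 - x5 - 2 * x4 - x3 - x2 - 1;
      x7 * x6 - 2 * x10 - x9 - x8 - x7 - x6 - 2 * x5 - x4 - x3 - x2 - x1;
      x8 * x6 - x10 - x9 - x7 - x6 - x4;
      x9 * x6 - x10 - x8 - x7 - x6 - x5;
      x10 * x6 - 4 * x10 - x9 - x8 - 2 * x7 - 2 * x6 - 2 * x5 - 2 * x4 - x3
        - x2;
      x7 ^+ 2 - 2 * x10 - x9 - x8 - x7 - x6 - x5 - 2 * x4 - x3 - x2 - 1;
      x8 * x7 - x10 - x8 - x7 - x6 - x5;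
      x9 * x7 - x10 - x9 - x7 - x6 - x4;
      x10 * x7 - 4 * x10 - x9 - x8 - 2 * x7 - 2 * x6 - 2 * x5 - 2 * x4 - x3
        - x2;
      x8 ^+ 2 - x9 - x7 - x4 - 1;
      x9 * x8 - x8 - x6 - x5 - x1;
      x10 * x8 - 2 * x10 - x7 - x6 - x5 - x4 - x3 - x2;
      x9 ^+ 2 - x9 - x7 - x4 - 1;
      x10 * x9 - 2 * x10 - x7 - x6 - x5 - x4 - x3 - x2;
      x10 ^+ 2 - 5 * x10 - 2 * x9 - 2 * x8 - 4 * x7 - 4 * x6 - 3 * x5
        - 3 * x4 - 2 * x3 - 2 * x2 - x1 - 1].

Lemma map_S6_relations (A B : comNzRingType) (f : {rmorphism A -> B})
    (x1 x2 x3 x4 x5 x6 x7 x8 x9 x10 : A) :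
  map f (S6_relations x1 x2 x3 x4 x5 x6 x7 x8 x9 x10) =
  S6_relations (f x1) (f x2) (f x3) (f x4) (f x5)
               (f x6) (f x7) (f x8) (f x9) (f x10).
Proof.
rewrite /S6_relations /=.
by do ?[congr (_ :: _); first by
  rewrite !(rmorphB, rmorphM, rmorphXn, rmorph1, rmorph_nat)].
Qed.

(* x_1, ..., x_10 are the variables of index 0, ..., 9. *)
Definition S6_gens : seq {mpoly int[10]} :=
  let x (k : nat) : {mpoly int[10]} := 'X_(inord k.-1) in
  S6_relations (x 1%N) (x 2%N) (x 3%N) (x 4%N) (x 5%N)
               (x 6%N) (x 7%N) (x 8%N) (x 9%N) (x 10%N).

Definition S6_ideal : {pred {mpoly int[10]}} := ideal_gen S6_gens.

(* Properness is witnessed by evaluating x_k at the degree of V_(k+1). *)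
Lemma S6_ideal_closed : idealr_closed S6_ideal.
Proof.
split.
- by apply/asboolP; exists (fun=> 0); rewrite big1 // => i _; rewrite mul0r.
- apply/negP=> /asboolP[c].
  pose d := [:: 1; 5; 5; 9; 9; 10; 10; 5; 5; 16] : seq int.
  pose ev : {rmorphism {mpoly int[10]} -> int} := meval (fun k : 'I_10 => d`_k).
  have evX k : (k < 10)%N -> ev 'X_(inord k) = d`_k.
    by move=> lt_k; rewrite /ev /= mevalXU inordK.
  have ev0 (i : 'I_(size S6_gens)) : ev S6_gens`_i = 0.
    have /allP all0: all (pred1 0) (map ev S6_gens).
      by rewrite map_S6_relations !evX.
    by apply/eqP/all0/map_f/mem_nth.
  move/(congr1 ev)/eqP; rewrite rmorph1 rmorph_sum big1 ?oner_eq0 // => i _.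
  by rewrite rmorphM ev0 mulr0.
- move=> a u v /asboolP[c ->] /asboolP[e ->]; apply/asboolP.
  exists (fun i => a * c i + e i); rewrite mulr_sumr -big_split.
  by apply: eq_bigr => i _; rewrite mulrDl mulrA.
Qed.

HB.instance Definition _ := isIdealr.Build {mpoly int[10]} S6_ideal S6_ideal_closed.

Notation Sym6 := [set: {perm 'I_6}]%G.

(* Columns of the table: the class of g_(j+1) is the set of permutations with
   cycle type S6_cycle_types`_j. *)
Definition S6_cycle_types : seq (seq nat) :=
  [:: [:: 1; 1; 1; 1; 1; 1]; [:: 2; 1; 1; 1; 1]; [:: 3; 2; 1]; [:: 2; 2; 2];
      [:: 4; 1; 1]; [:: 6]; [:: 2; 2; 1; 1]; [:: 3; 1; 1; 1]; [:: 5; 1];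
      [:: 4; 2]; [:: 3; 3]]%N.

Definition has_cycle_type (T : finType) (g : {perm T}) (s : seq nat) : bool :=
  perm_eq [seq #|B| | B : {set T} <- enum (porbits g)] s.

Definition S6_char_table : seq (seq int) :=
  [:: [:: 1; 1; 1; 1; 1; 1; 1; 1; 1; 1; 1];
      [:: 1; -1; -1; -1; -1; -1; 1; 1; 1; 1; 1];
      [:: 5; 3; 0; -1; 1; -1; 1; 2; 0; -1; -1];
      [:: 5; -3; 0; 1; -1; 1; 1; 2; 0; -1; -1];
      [:: 9; 3; 0; 3; -1; 0; 1; 0; -1; 1; 0];
      [:: 9; -3; 0; -3; 1; 0; 1; 0; -1; 1; 0];
      [:: 10; 2; -1; -2; 0; 1; -2; 1; 0; 0; 1];
      [:: 10; -2; 1; 2; 0; -1; -2; 1; 0; 0; 1];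
      [:: 5; 1; 1; -3; -1; 0; 1; -1; 0; -1; 2];
      [:: 5; -1; -1; 3; 1; 0; 1; -1; 0; -1; 2];
      [:: 16; 0; 0; 0; 0; 0; 0; -2; 1; 0; -2]].

(* Indices start from 0: V i stands for V_(i+1), and j for the class of g_(j+1). *)
Definition S6_irreducibles (F : numClosedFieldType)
    (V : 'I_11 -> representation F Sym6) : Prop :=
  (forall i, mx_irreducible (V i)) /\
  (forall (i j : 'I_11) (g : {perm 'I_6}),
     has_cycle_type g (nth [::] S6_cycle_types j) ->
     \tr (V i g) = ((nth [::] S6_char_table i)`_j)%:~R).

(* Main.v *)
Require Import Defs.
From HB Require Import structures.
From mathcomp Require Import all_boot all_order all_algebra all_fingroup.
From mathcomp Require Import all_solvable all_character.
From mathcomp Require Import mpoly complex.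
From mathcomp Require Import boolp reals.

Set Implicit Arguments.
Unset Strict Implicit.
Unset Printing Implicit Defensive.

Import Order.TTheory GRing.Theory Num.Theory.
Local Open Scope ring_scope.
Local Open Scope quotient_scope.

(** The 55 relations are the multiplication table of the irreducible characters:
    each one expresses a product x_j x_k as an integer combination of 1 and the
    variables. Two facts about this table give the isomorphism.

    First, the relations hold in the representation ring when x_k is replaced by
    the class of V_(k+1). An element of the representation ring is determined by
    its character, the value of the character at g is a ring morphism, and every
    permutation of six points has one of the listed cycle types; so it is enough
    to evaluate the relations on the eleven columns of the character table
    ([S6_rep_class_relations]). Hence evaluation of polynomials at the classes
    factors through a ring morphism psi from the quotient to the representation
    ring.

    Secondly, since every product of two variables is a combination of 1 and the
    variables modulo the ideal, 1 and the variables already span the quotient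
    over the integers ([S6_quot_span]).

    Now psi maps these eleven spanning elements to the classes of the V_i, which
    form a basis of the representation ring ([S6_irr_label_bij]): the V_i are
    pairwise non-isomorphic because degree and value at a transposition separate
    the rows of the table, and they exhaust the irreducible representations
    because the squares of their degrees add up to 720. A linear map that sends
    a spanning family to a basis is bijective, and the required isomorphism is
    the inverse of psi. *)

(** * Ring morphisms and quotients *)

Lemma bijective_rmorph_inverse (A B : nzRingType) (f : {rmorphism A -> B}) :
  bijective f -> exists g : {rmorphism B -> A}, cancel f g /\ cancel g f.
Proof.
case=> g fK gK.
pose gA := GRing.isZmodMorphism.Build _ _ g (can2_zmod_morphism fK gK).
pose gM := GRing.isMonoidMorphism.Build _ _ g (can2_monoid_morphism fK gK).
by exists (HB.pack g gA gM : {rmorphism B -> A}).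
Qed.

Lemma ideal_quot_lift (A : comNzRingType) (I : idealr A) (B : nzRingType)
    (f : {rmorphism A -> B}) :
    {in I, forall p, f p = 0} ->
  exists g : {rmorphism {ideal_quot I} -> B},
    forall p, g (\pi_({ideal_quot I}) p) = f p.
Proof.
move=> fI; pose g (q : {ideal_quot I}) := f (generic_quotient.repr q).
have gpi p : g (\pi p) = f p.
  apply/eqP; rewrite -subr_eq0 -rmorphB fI //.
  by rewrite Quotient.idealrBE reprK.
have gB : zmod_morphism g.
  move=> x y; rewrite -[x]reprK -[y]reprK -(rmorphB \pi).
  by rewrite !gpi rmorphB.
have gM : monoid_morphism g.
  split=> [|x y]; first by rewrite -(rmorph1 \pi) gpi rmorph1.
  by rewrite -[x]reprK -[y]reprK -(rmorphM \pi) !gpi rmorphM.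
pose gAS := GRing.isZmodMorphism.Build _ _ g gB.
pose gMS := GRing.isMonoidMorphism.Build _ _ g gM.
by exists (HB.pack g gAS gMS : {rmorphism _ -> _}).
Qed.

Lemma ideal_gen_ker (A : comNzRingType) (B : nzRingType)
    (f : {rmorphism A -> B}) (s : seq A) :
  {in s, forall y, f y = 0} -> {in ideal_gen s, forall p, f p = 0}.
Proof.
move=> fs0 p /asboolP[c ->]; rewrite rmorph_sum big1 // => i _.
by rewrite rmorphM (fs0 s`_i) ?mulr0 //; apply: mem_nth.
Qed.

Lemma mem_ideal_gen (A : comNzRingType) (s : seq A) : {subset s <= ideal_gen s}.
Proof.
move=> y /(nthP 0)[i lt_i <-]; apply/asboolP.
exists (fun j => (j == Ordinal lt_i)%:R).
rewrite (bigD1 (Ordinal lt_i)) //= eqxx mul1r big1 ?addr0 // => j /negPf ->.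
by rewrite mul0r.
Qed.

(** * Integer spans *)

Section IntSpan.
Variables (A : zmodType) (n : nat) (b : 'I_n -> A).

Definition int_span : {pred A} :=
  fun x => `[< exists c : 'I_n -> int, x = \sum_i b i *~ c i >].

Lemma int_span_closed : zmod_closed int_span.
Proof.
split=> [|x y /asboolP[c ->] /asboolP[d ->]]; apply/asboolP.
  by exists (fun=> 0); rewrite big1.
exists (fun i => c i - d i); rewrite -sumrB.
by apply: eq_bigr => i _; rewrite mulrzBr.
Qed.

HB.instance Definition _ := GRing.isZmodClosed.Build A int_span int_span_closed.

Lemma mem_int_span i : b i \in int_span.
Proof.
apply/asboolP; exists (fun j => (j == i)%:R).
rewrite (bigD1 i) //= eqxx mulr1z big1 ?addr0 // => j /negPf ->.
by rewrite mulr0z.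
Qed.

End IntSpan.

(** A monomial is reached from 1 by multiplying with one variable at a time, so
    a subgroup that contains 1 and is stable under these multiplications
    contains the image of every polynomial. *)
Lemma rmorph_mpoly_zmod (n : nat) (A : comNzRingType)
    (f : {rmorphism {mpoly int[n]} -> A}) (S : zmodClosed A) :
    1 \in S -> {in S, forall y k, y * f 'X_k \in S} ->
  forall p, f p \in S.
Proof.
move=> S1 SX p; rewrite (mpolyE p) rmorph_sum rpred_sum // => m _.
rewrite -mul_mpolyC rmorphM -[p@_m]intz !rmorph_int mulrzl rpredMz //.
rewrite mpolyXE_id rmorph_prod; elim/big_rec: _ => // k y _ Sy.
rewrite rmorphXn mulrC; elim: (m k) => [|i IHi]; first by rewrite mulr1.
by rewrite exprSr mulrA SX.
Qed.

(** * The relations as a family indexed by the variables *)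

Definition S6_relations_of (A : comNzRingType) (x : 'I_10 -> A) : seq A :=
  let y (k : nat) := x (inord k) in
  S6_relations (y 0%N) (y 1%N) (y 2%N) (y 3%N) (y 4%N)
               (y 5%N) (y 6%N) (y 7%N) (y 8%N) (y 9%N).

Lemma map_S6_relations_of (A B : comNzRingType) (f : {rmorphism A -> B})
    (x : 'I_10 -> A) :
  map f (S6_relations_of x) = S6_relations_of (f \o x).
Proof. exact: map_S6_relations. Qed.

Lemma S6_relations_of_nat (A : comNzRingType) (x : nat -> A) :
  S6_relations_of (fun k : 'I_10 => x k) =
  S6_relations (x 0%N) (x 1%N) (x 2%N) (x 3%N) (x 4%N)
               (x 5%N) (x 6%N) (x 7%N) (x 8%N) (x 9%N).
Proof. by rewrite /S6_relations_of !inordK. Qed.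

(** Each relation is a product of two variables minus elements of any subgroup
    that contains 1 and the variables; and every unordered pair of variables
    occurs in exactly one relation. *)
Lemma S6_relations_span (A : comNzRingType) (x : 'I_10 -> A)
    (S : zmodClosed A) :
    {in S6_relations_of x, forall r, r = 0} ->
    1 \in S -> (forall k, x k \in S) ->
  forall j k, x j * x k \in S.
Proof.
move=> rel0 S1 Sx; pose y k := x (inord k).
have Sy k : y k \in S by apply: Sx.
have Syn k n : n%:R * y k \in S by rewrite mulr_natl rpredMn.
have Srel : all (mem S) (S6_relations_of x).
  by apply/allP=> r /rel0 ->; rewrite inE rpred0.
suff Syy j k : (k <= j < 10)%N -> y j * y k \in S.
  move=> j k; rewrite -(inord_val j) -(inord_val k).
  have [le_kj | /ltnW le_jk] := leqP k j; first by rewrite Syy // le_kj /=.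
  by rewrite mulrC Syy // le_jk /=.
move: Srel; rewrite /S6_relations_of /= -!/(y _).
move: (y) Sy Syn => {rel0 Sx} z Sz Szn; rewrite !expr2.
rewrite !(rpredBr _ (Szn _ _), rpredBr _ (Sz _), rpredBr _ S1).
move=> Srel /andP[le_kj lt_j].
(* The relations list these pairs by increasing k, then by increasing j. *)
have /allP: all (fun p => z p.1 * z p.2 \in S)
    [seq (j, k) | k <- iota 0 10, j <- iota k (10 - k)] by exact: Srel.
move/(_ (j, k)); apply; apply/allpairsPdep; exists k, j; rewrite !mem_iota.
by rewrite subnKC ?(leq_ltn_trans le_kj) ?le_kj ?(leq_trans le_kj) // ltnW.
Qed.

(** * Cycle types *)

(** A composition of m + 1 is either 1 followed by a composition of m, or a
    composition of m whose first part is increased by 1. The composition of 1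
    arises both ways, since the head of the empty sequence defaults to 0. *)
Fixpoint compositions (n : nat) : seq (seq nat) :=
  if n is m.+1 then
    [seq 1%N :: s | s <- compositions m] ++
    [seq (head 0%N s).+1 :: behead s | s <- compositions m]
  else [:: [::]].

Lemma mem_compositions (s : seq nat) :
  all (leq 1) s -> s \in compositions (sumn s).
Proof.
move def_n: (sumn s) => n; elim: n s def_n => [|n IHn] [|[|a] s] //=.
rewrite addSn => -[sum_s] s_pos; rewrite mem_cat.
case: a sum_s => [|a] sum_s; first by rewrite map_f // IHn.
apply/orP; right; apply/mapP; exists (a.+1 :: s) => //.
exact: IHn.
Qed.

Lemma size_cycle_type (T : finType) (g : {perm T}) s :
  has_cycle_type g s -> size s = #|porbits g|.
Proof. by move/perm_size <-; rewrite size_map cardE. Qed.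

(** The orbit sizes of a permutation of six points form a composition of 6, and
    each of the compositions of 6 is a rearrangement of a listed cycle type. *)
Lemma S6_cycle_type (g : {perm 'I_6}) :
  exists j : 'I_11, has_cycle_type g (nth [::] S6_cycle_types j).
Proof.
pose s := [seq #|B| | B : {set 'I_6} <- enum (porbits g)].
have part : partition (porbits g) [set: 'I_6].
  have -> : porbits g = orbit 'P <[g]>%g @: [set: 'I_6].
    rewrite -porbitE; apply/setP=> B.
    by apply/imsetP/imsetP=> -[x _ ->]; exists x.
  by apply: orbit_partition; apply/actsP=> a _ x; rewrite !inE.
have s_sum : sumn s = 6.
  by rewrite sumnE big_map big_enum -(card_partition part) cardsT card_ord.
have s_pos : all (leq 1) s.
  apply/allP=> _ /mapP[B + ->]; rewrite mem_enum => /imsetP[x _ ->].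
  by apply/card_gt0P; exists x; apply: porbit_id.
have := mem_compositions s_pos; rewrite s_sum.
have /allP/[apply]: all (fun t => has (perm_eq t) S6_cycle_types)
    (compositions 6) by vm_compute.
case/(has_nthP [::])=> j lt_j s_j.
by exists (Ordinal lt_j).
Qed.

Lemma card_porbits1 (T : finType) : #|porbits (1 : {perm T})%g| = #|T|.
Proof.
rewrite /porbits card_imset // => x y /setP/(_ x).
rewrite porbit_id => /esym/porbitP[n ->].
by rewrite expg1n perm1.
Qed.

Lemma card_porbits_tperm (T : finType) (x y : T) :
  x != y -> #|porbits (tperm x y)|.+1 = #|T|.
Proof.
move=> neq_xy; have /= := porbits_mul_tperm 1%g x y.
rewrite mulg1 neq_xy card_porbits1 /=.
have -> : x \notin porbit 1 y.
  by apply/porbitP=> -[n]; rewrite expg1n perm1; apply/eqP.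
by rewrite addn1 addn2 => -[].
Qed.

(** Only one partition of 6 has six parts, and only one has five, so in these
    cases the number of orbits determines the cycle type. *)
Lemma S6_cycle_type_by_card (g : {perm 'I_6}) k :
    (k < 2)%N -> (#|porbits g| + k)%N = 6 ->
  has_cycle_type g (nth [::] S6_cycle_types k).
Proof.
move=> lt_k; have [[j lt_j] gj] := S6_cycle_type g.
rewrite -(size_cycle_type gj).
by case: k lt_k => [|[|k]] // _; do 11?[case: j lt_j gj => [|j] lt_j gj //].
Qed.

Lemma S6_cycle_type_id :
  has_cycle_type (1 : {perm 'I_6})%g (nth [::] S6_cycle_types 0).
Proof. by apply: S6_cycle_type_by_card; rewrite // card_porbits1 card_ord. Qed.

Lemma S6_cycle_type_tperm :
  has_cycle_type (tperm ord0 ord_max : {perm 'I_6}) (nth [::] S6_cycle_types 1).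
Proof.
by apply: S6_cycle_type_by_card; rewrite // addn1 card_porbits_tperm ?card_ord.
Qed.

(** * Families of irreducible representations *)

Lemma rep_char_rmorph (F : numClosedFieldType) (gT : finGroupType)
    (G : {group gT}) (g : gT) :
    g \in G ->
  exists chi : {rmorphism rep_ring F G -> F}, forall x, chi x = rep_char x g.
Proof.
move=> Gg; pose ch (x : rep_ring F G) := rep_char x g.
have chB : zmod_morphism ch by move=> x y; apply: rep_charB.
have chM : monoid_morphism ch.
  by split=> [|x y]; [apply: rep_char1 | apply: rep_charM].
pose chBS := GRing.isZmodMorphism.Build _ _ _ chB.
pose chMS := GRing.isMonoidMorphism.Build _ _ _ chM.
by exists (HB.pack ch chBS chMS : {rmorphism _ -> _}).
Qed.

Section IrreducibleFamily.
Variables (F : numClosedFieldType) (gT : finGroupType) (G : {group gT}).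
Variables (n : nat) (V : 'I_n -> representation F G).
Hypothesis irrV : forall i, mx_irreducible (V i).

Definition irr_label i : irrep_index F G := irr_comp (irrep_index F G) (V i).

Lemma rsim_irr_label i : mx_rsim (V i) (irr_repr (irr_label i)).
Proof.
exact: (@rsim_irr_comp_pchar F gT G (irrep_index F G) (pchar'_group F G)
          _ _ (irrV i)).
Qed.

Lemma rep_class_irr_label i :
  rep_class (V i) = [ffun W => (W == irr_label i)%:Z].
Proof.
rewrite -rep_class_irr.
exact: (@rep_class_rsim F gT G (V i) (irr_grepr _) (rsim_irr_label i)).
Qed.

Lemma mxtrace_irr_label i j :
  irr_label i = irr_label j -> {in G, forall g, \tr (V i g) = \tr (V j g)}.
Proof.
move=> eq_ij g Gg; rewrite (mxtrace_rsim (rsim_irr_label i) Gg) eq_ij.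
by rewrite -(mxtrace_rsim (rsim_irr_label j) Gg).
Qed.

Lemma mxtrace_irr_label1 i : \tr (V i 1%g) = (irr_degree (irr_label i))%:R.
Proof. by rewrite (mxtrace_rsim (rsim_irr_label i)) // repr_mx1 mxtrace1. Qed.

(** The squares of all the irreducible degrees add up to the order of G; when
    the members of the family account for the whole sum, a further irreducible
    representation would have degree 0. *)
Lemma irr_label_bij :
  injective irr_label -> (\sum_i irr_degree (irr_label i) ^ 2 = #|G|)%N ->
  bijective irr_label.
Proof.
move=> label_inj sum_deg; apply: inj_card_bij => //.
rewrite -(card_codom label_inj); apply/subset_leq_card/subsetP => W _.
apply: contraT => notW.
have := sum_irr_degree_pchar (irrep_index F G) (pchar'_group F G)
  (@group_closure_closed_field F gT G).
rewrite (bigID (mem (codom irr_label))) /= -sum_deg.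
have -> : (\sum_(U in codom irr_label) irr_degree U ^ 2
           = \sum_i irr_degree (irr_label i) ^ 2)%N.
  by rewrite -big_uniq ?big_image //; apply/injectiveP.
rewrite (bigD1 W) //= => /eqP; rewrite -[X in _ == X]addn0 eqn_add2l addn_eq0.
by rewrite expn_eq0 (gtn_eqF (irr_degree_gt0 W)).
Qed.

Hypothesis label_bij : bijective irr_label.

Lemma rep_class_free (c : 'I_n -> int) :
  \sum_i rep_class (V i) *~ c i = 0 -> forall i, c i = 0.
Proof.
move=> sum0 i.
move/(congr1 (fun x : rep_ring F G => x (irr_label i))): sum0.
rewrite ffunE sum_ffunE (bigD1 i) //= big1 => [|j neq_ji];
  rewrite ffunMzE rep_class_irr_label ffunE.
  by rewrite eqxx addr0 intz.
by rewrite (inj_eq (bij_inj label_bij)) eq_sym (negPf neq_ji) mul0rz.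
Qed.

Lemma rep_class_coord (x : rep_ring F G) :
  x = \sum_i rep_class (V i) *~ x (irr_label i).
Proof.
rewrite {1}[x]rep_ring_basis (reindex irr_label) /=; last exact: onW_bij.
by apply: eq_bigr => i _; rewrite rep_class_irr -rep_class_irr_label.
Qed.

End IrreducibleFamily.

(** * The character table of S6 *)

Definition S6_chi (i j : nat) : int := (nth [::] S6_char_table i)`_j.

(** The list [iota 0 n] reduces to an explicit one, whereas the enumeration of
    the ordinals does not; so the left-hand side can be decided by computation. *)
Lemma forall_ord_iota n (P : pred nat) :
  all P (iota 0 n) -> forall i : 'I_n, P i.
Proof. by move/allP=> allP i; rewrite allP // mem_iota ltn_ord. Qed.

Lemma S6_char_table_relations (j : 'I_11) :
  all (pred1 0) (S6_relations_of (fun k : 'I_10 => S6_chi k.+1 j)).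
Proof.
rewrite (S6_relations_of_nat (fun k => S6_chi k.+1 j)).
move: j; apply: (forall_ord_iota (P := fun j => all (pred1 0)
  (S6_relations (S6_chi 1 j) (S6_chi 2 j) (S6_chi 3 j) (S6_chi 4 j)
     (S6_chi 5 j) (S6_chi 6 j) (S6_chi 7 j) (S6_chi 8 j) (S6_chi 9 j)
     (S6_chi 10 j)))).
by vm_compute.
Qed.

Section S6Irreducibles.
Variables (F : numClosedFieldType) (V : 'I_11 -> representation F Sym6).
Hypothesis hV : S6_irreducibles V.

(** Columns 0 and 1 of the table, the degree and the value at a transposition,
    are enough to tell the rows apart. *)
Lemma S6_irr_label_inj : injective (irr_label V).
Proof.
move=> i j eq_ij.
have eq_chi (k : 'I_11) (g : {perm 'I_6}) :
  has_cycle_type g (nth [::] S6_cycle_types k) -> S6_chi i k = S6_chi j k.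
  move=> gk; apply: (@intr_inj F); rewrite /S6_chi.
  by rewrite -!(hV.2 _ k g gk) (mxtrace_irr_label hV.1 eq_ij) ?inE.
have chi0 : S6_chi i 0 = S6_chi j 0 := eq_chi ord0 _ S6_cycle_type_id.
have chi1 : S6_chi i 1 = S6_chi j 1 :=
  eq_chi (lift ord0 ord0) _ S6_cycle_type_tperm.
pose sep i j := ((S6_chi i 0 == S6_chi j 0) && (S6_chi i 1 == S6_chi j 1)
                 ==> (i == j))%N.
have /forall_ord_iota/(_ i)/forall_ord_iota/(_ j):
  all (fun i => all (sep i) (iota 0 11)) (iota 0 11) by vm_compute.
by rewrite /sep chi0 chi1 !eqxx => /eqP/val_inj.
Qed.

Lemma S6_irr_label_bij : bijective (irr_label V).
Proof.
apply: (irr_label_bij S6_irr_label_inj).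
have deg i : irr_degree (irr_label V i) = `|S6_chi i 0|%N.
  apply/eqP; rewrite -(eqr_nat F) -(mxtrace_irr_label1 hV.1).
  rewrite (hV.2 i ord0 1%g S6_cycle_type_id) pmulrn.
  apply/eqP; congr (_%:~R).
  have /forall_ord_iota/(_ i)/eqP //: all
    (fun i => S6_chi i 0 == Posz (absz (S6_chi i 0))) (iota 0 11).
  by vm_compute.
under eq_bigr => i _ do rewrite deg.
by rewrite cardsT card_Sn !big_ord_recl big_ord0.
Qed.

Lemma S6_rep_class_relations :
  {in S6_relations_of (fun k => rep_class (V (lift ord0 k))), forall r, r = 0}.
Proof.
move=> r rel_r; apply: rep_char_inj => g Gg; rewrite rep_char0.
have [chi chiE] := rep_char_rmorph F Gg; rewrite -chiE.
have [j gj] := S6_cycle_type g.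
have : chi r \in
    map chi (S6_relations_of (fun k => rep_class (V (lift ord0 k)))).
  exact: map_f.
rewrite map_S6_relations_of.
have -> : chi \o (fun k => rep_class (V (lift ord0 k))) =
    intr \o (fun k : 'I_10 => S6_chi k.+1 j).
  by apply: funext => k /=; rewrite chiE rep_charE // (hV.2 _ j).
rewrite -map_S6_relations_of => /mapP[z rel_z ->].
by have /allP/(_ z rel_z)/eqP -> := S6_char_table_relations j.
Qed.

Lemma S6_rep_class_triv : rep_class (V ord0) = 1.
Proof.
apply: rep_char_inj => g Gg; have [j gj] := S6_cycle_type g.
rewrite rep_charE // (hV.2 _ j) // rep_char1 //.
suff chi0 : S6_chi 0 j = 1 by rewrite [_`_j]chi0.
apply/eqP; apply: (forall_ord_iota (P := fun j => S6_chi 0 j == 1)).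
by vm_compute.
Qed.

End S6Irreducibles.

(** * The quotient ring *)

Definition one_and_gens (A : nzRingType) n (x : 'I_n -> A) (i : 'I_n.+1) : A :=
  oapp x 1 (unlift ord0 i).

(** By [S6_relations_span], the span of 1 and the variables is stable under
    multiplication by a variable. *)
Lemma S6_quot_span (q : {ideal_quot S6_ideal}) :
  q \in int_span (one_and_gens (fun k => \pi_({ideal_quot S6_ideal}) 'X_k)).
Proof.
set b := one_and_gens _.
have b0 : b ord0 = 1 by rewrite /b /one_and_gens unlift_none.
have bS k : b (lift ord0 k) = \pi 'X_k by rewrite /b /one_and_gens liftK.
have S1 : 1 \in int_span b by rewrite -b0 mem_int_span.
have SX k : \pi_({ideal_quot S6_ideal}) 'X_k \in int_span b.
  by rewrite -bS mem_int_span.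
have SXX :=
  S6_relations_span (x := fun k => \pi_({ideal_quot S6_ideal}) 'X_k) _ S1 SX.
rewrite -[q]reprK; apply: rmorph_mpoly_zmod => // _ /asboolP[c ->] k.
rewrite mulr_suml rpred_sum // => i _; rewrite mulrzAl rpredMz //.
case: (unliftP ord0 i) => [j|] ->; rewrite ?b0 ?bS ?mul1r; last exact: SX.
pose pi : {rmorphism {mpoly int[10]} -> {ideal_quot S6_ideal}} :=
  \pi_({ideal_quot S6_ideal}).
apply: SXX => r; rewrite -(map_S6_relations_of pi (fun k => 'X_k)).
case/mapP=> p rel_p ->; rewrite -(rmorph0 pi).
apply/eqP; rewrite -Quotient.idealrBE subr0.
exact: mem_ideal_gen.
Qed.

Theorem theorem8 (R : realType) (V : 'I_11 -> representation R[i] Sym6)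
    (hV : S6_irreducibles V) :
  exists f : {rmorphism rep_ring R[i] Sym6 -> {ideal_quot S6_ideal}},
    [/\ bijective f,
        f (rep_class (V ord0)) = 1 &
        forall k : 'I_10,
          f (rep_class (V (lift ord0 k))) = \pi_({ideal_quot S6_ideal}) 'X_k].
Proof.
pose e k := rep_class (V (lift ord0 k)).
pose phi : {rmorphism {mpoly int[10]} -> rep_ring R[i] Sym6} := mmap intr e.
have phiX k : phi 'X_k = e k by rewrite /phi /= mmapX mmap1U.
have phi0 : {in S6_ideal, forall p, phi p = 0}.
  apply: ideal_gen_ker => p gen_p; apply: (S6_rep_class_relations hV).
  have -> : (fun k => rep_class (V (lift ord0 k))) = phi \o (fun k => 'X_k).
    by apply: funext => k /=; rewrite phiX.
  by rewrite -map_S6_relations_of map_f.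
have [psi psiE] := ideal_quot_lift phi0.
have psiX k : psi (\pi 'X_k) = e k by rewrite psiE phiX.
pose b := one_and_gens (fun k => \pi_({ideal_quot S6_ideal}) 'X_k).
have psib i : psi (b i) = rep_class (V i).
  rewrite /b /one_and_gens; case: unliftP => [k|] -> /=; first exact: psiX.
  by rewrite rmorph1 (S6_rep_class_triv hV).
have psi_sum (c : 'I_11 -> int) :
    psi (\sum_i b i *~ c i) = \sum_i rep_class (V i) *~ c i.
  by rewrite rmorph_sum; apply: eq_bigr => i _; rewrite rmorphMz psib.
have label_bij := S6_irr_label_bij hV.
have psi_inj : injective psi.
  apply: raddf_inj => q; have /asboolP[c ->] := S6_quot_span q => psi0.
  have := psi_sum c; rewrite [LHS]psi0 => /esym.
  move=> /(rep_class_free hV.1 label_bij) c0.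
  by rewrite big1 // => i _; rewrite c0.
have psi_bij : bijective psi.
  pose g (x : rep_ring R[i] Sym6) := \sum_i b i *~ x (irr_label V i).
  have gK : cancel g psi.
    by move=> x; rewrite psi_sum -(rep_class_coord hV.1 label_bij).
  by exists g => // q; apply: psi_inj; rewrite gK.
have [f [psiK fK]] := bijective_rmorph_inverse psi_bij.
exists f; split=> [||k]; first by exists psi.
  by rewrite (S6_rep_class_triv hV) rmorph1.
by rewrite -/(e k) -psiX psiK.
Qed.
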